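(* Let $a,b,c,d,e,f,g,h\in\mathbb{Z}_{>0}$ with $\frac ef<\frac ab$ and $\frac gh<\frac cd$, and let $\Delta$ denote the (closed) triangle with vertices $\left(\frac ef,\frac gh\right)$, $\left(\frac ab,\frac gh\right)$ and $\left(\frac ef,\frac cd\right)$. Define $\alpha:=dh(be-af)$, $\beta:=bf(ch-dg)$ (so $\alpha<0<\beta$), and $l(x):=\frac{\beta}{\alpha}x+\frac cd-\frac{e\beta}{f\alpha}$. Then the integer-point transform of $\Delta$ equals, as an identity of rational functions in $x$ and $y$, \[ \sigma_\Delta(x,y)=\frac{x^{\lceil e/f\rceil}y^{\lceil g/h\rceil}}{(1-x)(1-y)} +\frac{\mathrm{R}\left(x,y,\frac gh,l^{-1}\right)}{(1-x^{-1})(1-x^{\alpha}y^{\beta})} +\frac{\mathrm{R}\left(y,x,\frac ef,l\right)}{(1-y^{-1})(1-x^{-\alpha}y^{-\beta})}, \] where \[ \mathrm{R}\left(x,y,\tfrac gh,l^{-1}\right)=\sum_{k=\lceil g/h\rceil}^{\lceil g/h\rceil+\beta-1}x^{\lfloor l^{-1}(k)\rfloor}y^k, \qquad \mathrm{R}\left(y,x,\tfrac ef,l\right)=\sum_{k=\lceil e/f\rceil}^{\lceil e/f\rceil+|\alpha|-1}x^k y^{\lfloor l(k)\rfloor}. \]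
   Context: The integer-point transform of a rational polygon $\mathcal{P}\subset\mathbb{R}^2$ is $\sigma_{\mathcal P}(x,y):=\sum_{(m,n)\in\mathcal{P}\cap\mathbb{Z}^2}x^my^n$. For a linear function $F(x)=\frac{Ax+T}{B}$ with $A\in\mathbb{Z}$ nonzero, $B\in\mathbb{Z}_{>0}$ and $T\in\mathbb{R}$, a real number $s$, and variables $u,v$, the Rademacher--Carlitz polynomial (in general a Laurent polynomial) is $\mathrm{R}(u,v,s,F):=\sum_{k=\lceil s\rceil}^{\lceil s\rceil+B-1}u^{\lfloor F(k)\rfloor}v^k$, where $B$ is the denominator in the given expression of $F$. Here $l$ is taken with denominator $|\alpha|=-\alpha$, and its inverse function $l^{-1}$ with denominator $\beta$. The line $y=l(x)$ contains the hypotenuse of $\Delta$. *)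

(* Defs.v *)
From mathcomp Require Import all_boot all_order all_algebra.
From mathcomp Require Import all_classical all_reals ring.

Set Implicit Arguments.
Unset Strict Implicit.
Unset Printing Implicit Defensive.

Import Order.TTheory GRing.Theory Num.Theory.
Local Open Scope classical_set_scope.
Local Open Scope ring_scope.

(* K(x, y) is the fraction field of K[y][x], with x = 'X, y = 'Y as in polyXY. *)
Definition ratfun2 (K : fieldType) := {fraction {poly {poly K}}}.

Definition ratx (K : fieldType) : ratfun2 K := tofrac 'X.
Definition raty (K : fieldType) : ratfun2 K := tofrac 'Y.

Definition triangle (R : realType) (p q r : R * R) : set (R * R) :=
  [set z | exists s t w : R,
    [/\ 0 <= s, 0 <= t, 0 <= w, s + t + w = 1
      & z = (s * p.1 + t * q.1 + w * r.1, s * p.2 + t * q.2 + w * r.2)]].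

(* A finitely supported sum: meaningful for sets P with finitely many integer
   points (in particular bounded ones), and 0 by convention when P has
   infinitely many and x, y are nonzero. *)
Definition integer_point_transform (R : realType) (L : fieldType)
    (P : set (R * R)) (x y : L) : L :=
  \sum_(p \in [set p : int * int | P (p.1%:~R, p.2%:~R)]) x ^ p.1 * y ^ p.2.

(* The expression (A t + T) / B.  It is kept as a record rather than as a
   function, since Rademacher-Carlitz polynomials depend on the denominator B
   of the expression and not only on the function. *)
Record linexpr (R : realType) := LinExpr {
  lnum : int;
  lshift : R;
  lden : int;
  lnum_neq0 : lnum != 0;
  lden_gt0 : 0 < lden }.

Definition linexpr_eval (R : realType) (F : linexpr R) (t : R) : R :=
  ((lnum F)%:~R * t + lshift F) / (lden F)%:~R.

Coercion linexpr_eval : linexpr >-> Funclass.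

Definition rademacher_carlitz (R : realType) (L : fieldType)
    (u v : L) (s : R) (F : linexpr R) : L :=
  \sum_(k \in [set k : int | Num.ceil s <= k <= Num.ceil s + lden F - 1])
    u ^ Num.floor (F k%:~R) * v ^ k.

(* A line of slope beta / alpha with alpha < 0 < beta has an expression with
   denominator |alpha|, and its inverse has one with denominator beta. *)
Lemma linexpr_inverse_exists (R : realType) (alpha beta : int) (n : R) :
  alpha < 0 -> 0 < beta ->
  exists l linv : linexpr R,
    [/\ forall t, l t = beta%:~R / alpha%:~R * t + n,
        lden l = `|alpha|, cancel l linv, cancel linv l & lden linv = beta].
Proof.
move=> a0 b0.
have bn0 : - beta != 0 by rewrite oppr_eq0 gt_eqF.
have an0 : alpha != 0 by rewrite lt_eqF.
have na0 : 0 < - alpha by rewrite oppr_gt0.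
have aR : alpha%:~R != 0 :> R by rewrite intr_eq0.
have bR : beta%:~R != 0 :> R by rewrite intr_eq0 gt_eqF.
exists (LinExpr (- (alpha%:~R * n)) bn0 na0), (LinExpr (- (alpha%:~R * n)) an0 b0).
split => [t||t|t|] //=; rewrite ?ltr0_norm // /linexpr_eval /= ?mulrNz.
- by field.
- by field; rewrite aR bR.
- by field; rewrite aR bR.
Qed.

(* Main.v *)
Require Import Defs.
From mathcomp Require Import all_boot all_order all_algebra.
From mathcomp Require Import all_classical all_reals.
From mathcomp Require Import ring lra zify.

Set Implicit Arguments.
Unset Strict Implicit.
Unset Printing Implicit Defensive.

Import Order.TTheory GRing.Theory Num.Theory.
Local Open Scope ring_scope.

(** The right-hand side is the sum of the generating functions of the three
    vertex cones of the triangle, so the theorem is an instance of Brion's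
    theorem.  The proof below avoids generating functions of infinite cones:
    it lets the right-angled corner of the triangle move and follows the
    right-hand side as a function of that corner.

    Let [p], [q] be the ceilings of [e/f], [g/h], and for integers [m], [n] let
    [L m] and [M n] be the floors of [l m] and [linv n].  Since [l] is
    decreasing, [n <= L m] and [m <= M n] both say that [(m, n)] is on or below
    the line: [L] and [M] form an antitone Galois connection.  With
    [A = - alpha] and [B = beta], they satisfy [L (m + A) = L m - B] and
    [M (n + B) = M n - A].  The right-hand side, [vertex_cone_sum] at [(p, q)],
    then makes sense for every corner [(p, q)] and obeys three rules.

    - Raising [q] by one removes the geometric sum of row [q], from column [p]
      to column [M q] ([vertex_cone_sum_row]): the window of the
      Rademacher-Carlitz sum slides by one period, which cancels the factor
      [1 - x ^ alpha * y ^ beta].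
    - Raising [p] by one does the same with columns
      ([vertex_cone_sum_column]).
    - Translating the corner by [(A, - B)], along the line, multiplies the
      expression by [x ^ A * y ^ (- B)] ([vertex_cone_sum_translate]).

    Moving the corner along the staircase just above the line only removes
    empty rows and columns, so there the expression is constant; the third rule
    says that it is also multiplied by [x ^ A * y ^ (- B)], which is not [1].
    Hence it vanishes on the staircase ([vertex_cone_sum_eq0]), and climbing
    from [(p, q)] to the staircase row by row collects exactly the lattice
    points of the triangle ([vertex_cone_sum_lattice_points]). *)

(** * Geometric and periodic sums over integers *)

Lemma eq_int_lower_set (m n : int) : (forall k : int, (k <= m) = (k <= n)) -> m = n.
Proof. by move=> H; apply/le_anti; rewrite -H lexx H lexx. Qed.

(** The two terms are the expansions of the rays leaving the two ends of the
    segment inwards: Brion's theorem in dimension one.  An empty segment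
    ([w = 0]) is allowed, and then the two rays cancel. *)
Lemma geometric_sum_expz (F : fieldType) (x : F) (p : int) (w : nat) :
  x != 0 -> x != 1 ->
  \sum_(j < w) x ^ (p + j%:Z)
  = x ^ p / (1 - x) + x ^ (p + w%:Z - 1) / (1 - x^-1).
Proof.
move=> x0 x1.
have x1' : 1 - x != 0 by rewrite subr_eq0 eq_sym.
have x2 : x - 1 != 0 by rewrite subr_eq0.
rewrite !expfzDr // exprN1.
elim: w => [|w IH].
  by rewrite big_ord0 expr0z; field; rewrite x0 x1' x2.
rewrite big_ord_recr /= IH expfzDr // -!exprnP exprS.
by field; rewrite x0 x1' x2.
Qed.

(** Sliding a window of one period of a quasi-periodic [g] trades its first
    term for [z] times that term.  This is why the quotient of the window sum
    by [1 - z] behaves like the infinite sum of [g] from [q] on. *)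
Lemma sum_ord_window (F : fieldType) (g : int -> F) (z : F) (B : nat) (q : int) :
  g (q + B%:Z) = z * g q ->
  \sum_(k < B) g (q + k%:Z)
  = (1 - z) * g q + \sum_(k < B) g (q + 1 + k%:Z).
Proof.
move=> gB; rewrite mulrBl mul1r -gB.
(* The sum over a window of length [B.+1] is split at either end. *)
have : \sum_(k < B.+1) g (q + k%:Z) = \sum_(k < B.+1) g (q + k%:Z) by [].
rewrite [LHS]big_ord_recr [RHS]big_ord_recl /= addr0.
move=> /(canRL (addrK _)) ->.
rewrite addrAC; congr (_ + _); apply: eq_bigr => i _.
by congr g; rewrite /bump; lia.
Qed.

(** * The three vertex cones as a function of the corner *)

(** The lattice triangle has its right angle at [(p, q)] and is bounded above by
    the staircase [n <= L m], equivalently [m <= M n].  The summands are the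
    rational functions of the cones at the right angle, at the end of the
    bottom side and at the end of the left side. *)
Definition vertex_cone_sum (F : fieldType) (x y : F) (L M : int -> int)
    (A B : nat) (p q : int) : F :=
  x ^ p * y ^ q / ((1 - x) * (1 - y))
  + (\sum_(k < B) x ^ M (q + k%:Z) * y ^ (q + k%:Z))
      / ((1 - x^-1) * (1 - x ^ (- A%:Z) * y ^ B%:Z))
  + (\sum_(k < A) y ^ L (p + k%:Z) * x ^ (p + k%:Z))
      / ((1 - y^-1) * (1 - x ^ A%:Z * y ^ (- B%:Z))).

(** Reflecting the plane in the diagonal exchanges the two acute vertices; this
    halves the work, as columns become rows. *)
Lemma vertex_cone_sumC (F : fieldType) (x y : F) (L M : int -> int)
    (A B : nat) (p q : int) :
  vertex_cone_sum x y L M A B p q = vertex_cone_sum y x M L B A q p.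
Proof.
rewrite /vertex_cone_sum addrAC [y ^ q * _]mulrC [(1 - y) * _]mulrC.
by rewrite [y ^ (- _) * _]mulrC [y ^ _%:Z * x ^ _]mulrC.
Qed.

Definition antitone_galois (L M : int -> int) :=
  forall m n, (n <= L m) = (m <= M n).

Lemma antitone_galois_period L M (A B : int) :
  antitone_galois L M -> (forall m, L (m + A) = L m - B) ->
  forall n, M (n + B) = M n - A.
Proof.
move=> G LA n; apply: eq_int_lower_set => k.
by rewrite -G -lerBrDr -LA G lerBrDr.
Qed.

(** Only the first two cones change.  The difference of the first ones is the
    ray of row [q] going right from column [p], and the difference of the
    second ones is the ray going left from column [M q]. *)
Lemma vertex_cone_sum_row (F : fieldType) (x y : F)
    (L M : int -> int) (A B : nat) (p q : int) :
  x != 0 -> x != 1 -> y != 0 -> y != 1 ->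
  x ^ (- A%:Z) * y ^ B%:Z != 1 ->
  (forall n, M (n + B%:Z) = M n - A%:Z) ->
  vertex_cone_sum x y L M A B p q
  = y ^ q * (x ^ p / (1 - x) + x ^ M q / (1 - x^-1))
    + vertex_cone_sum x y L M A B p (q + 1).
Proof.
move=> x0 x1 y0 y1 z1 MB; rewrite /vertex_cone_sum.
have -> := @sum_ord_window _ (fun n => x ^ M n * y ^ n) (x ^ (- A%:Z) * y ^ B%:Z) B q.
  set S1 := \sum_(k < B) _; set S2 := \sum_(k < A) _.
  rewrite [y ^ (q + 1)]expfzDr // expr1z.
  move: z1; set z := x ^ _ * y ^ _ => z1.
  set w := (1 - y^-1) * _.
  have z2 : 1 - z != 0 by rewrite subr_eq0 eq_sym.
  have x1' : 1 - x != 0 by rewrite subr_eq0 eq_sym.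
  have x2 : x - 1 != 0 by rewrite subr_eq0.
  have y1' : 1 - y != 0 by rewrite subr_eq0 eq_sym.
  (* Locked, the third cone is an atom: its denominator raises no side condition. *)
  rewrite [S2 / w]lock; field.
  by rewrite x0 x1' x2 y1' z2.
by rewrite MB !expfzDr // mulrACA mulrC.
Qed.

Lemma vertex_cone_sum_column (F : fieldType) (x y : F)
    (L M : int -> int) (A B : nat) (p q : int) :
  x != 0 -> x != 1 -> y != 0 -> y != 1 ->
  x ^ (- A%:Z) * y ^ B%:Z != 1 ->
  (forall m, L (m + A%:Z) = L m - B%:Z) ->
  vertex_cone_sum x y L M A B p q
  = x ^ p * (y ^ q / (1 - y) + y ^ L p / (1 - y^-1))
    + vertex_cone_sum x y L M A B (p + 1) q.
Proof.
move=> x0 x1 y0 y1 z1 LA; rewrite vertex_cone_sumC vertex_cone_sum_row //.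
  by rewrite -vertex_cone_sumC.
by rewrite -invr_eq1 invfM !invr_expz opprK mulrC.
Qed.

(** The line is invariant under translation by [(A, - B)], hence so are the
    shapes of the three cones. *)
Lemma vertex_cone_sum_translate (F : fieldType) (x y : F)
    (L M : int -> int) (A B : nat) (p q : int) :
  x != 0 -> y != 0 ->
  (forall m, L (m + A%:Z) = L m - B%:Z) ->
  (forall n, M (n + B%:Z) = M n - A%:Z) ->
  vertex_cone_sum x y L M A B (p + A%:Z) (q - B%:Z)
  = x ^ A%:Z * y ^ (- B%:Z) * vertex_cone_sum x y L M A B p q.
Proof.
move=> x0 y0 LA MB; rewrite /vertex_cone_sum [RHS]mulrDr [X in _ = X + _]mulrDr.
congr (_ + _ + _); rewrite [RHS]mulrA; congr (_ / _).
- by rewrite !expfzDr // mulrACA mulrC.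
- rewrite mulr_sumr; apply: eq_bigr => k _.
  have -> : M (q - B%:Z + k%:Z) = M (q + k%:Z) + A%:Z.
    by rewrite -[q + k%:Z](subrK B%:Z) MB subrK addrAC.
  by rewrite addrAC !expfzDr // !mulrA; ring.
- rewrite mulr_sumr; apply: eq_bigr => k _.
  by rewrite addrAC LA !expfzDr // !mulrA; ring.
Qed.

(** The bound [p - 1 <= M (q + i)], rather than [p <= M (q + i)], admits empty
    rows; a row ending further left would contribute the negative of the terms
    missing between its end and column [p]. *)
Lemma vertex_cone_sum_rows (F : fieldType) (x y : F)
    (L M : int -> int) (A B : nat) (p q : int) (N : nat) :
  x != 0 -> x != 1 -> y != 0 -> y != 1 ->
  x ^ (- A%:Z) * y ^ B%:Z != 1 ->
  (forall n, M (n + B%:Z) = M n - A%:Z) ->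
  (forall i : nat, (i < N)%N -> p - 1 <= M (q + i%:Z)) ->
  vertex_cone_sum x y L M A B p q
  = \sum_(i < N) \sum_(j < absz (M (q + i%:Z) + 1 - p)%R)
      x ^ (p + j%:Z) * y ^ (q + i%:Z)
    + vertex_cone_sum x y L M A B p (q + N%:Z).
Proof.
move=> x0 x1 y0 y1 z1 MB; elim: N => [|N IH] Mp.
  by rewrite big_ord0 addr0 add0r.
rewrite big_ord_recr /= IH; last by move=> i iN; apply: Mp; lia.
rewrite -addrA; congr (_ + _); rewrite vertex_cone_sum_row //.
rewrite -mulr_suml geometric_sum_expz // mulrC.
have := Mp N (ltnSn N) => MpN.
congr ((_ + x ^ _ / _) * _ + vertex_cone_sum _ _ _ _ _ _ _ _); lia.
Qed.

Lemma int_succ_invariant (T : Type) (G : int -> T) :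
  (forall p, G p = G (p + 1)) -> forall p (k : nat), G p = G (p + k%:Z).
Proof.
move=> GS p; elim=> [|k ->]; first by rewrite addr0.
by rewrite GS; congr G; lia.
Qed.

(** In column [p - 1], the lowest lattice point above the line is at height
    [L (p - 1) + 1].  Moving the corner down to height [L p + 1] adds rows that end at column
    [p - 1], hence are empty; moving it right to column [p + 1] removes a column
    that is empty as well.  So the value does not depend on [p], whereas the
    translation rule multiplies it by a factor different from [1] when [p]
    grows by [A]. *)
Lemma vertex_cone_sum_eq0 (F : fieldType) (x y : F)
    (L M : int -> int) (A B : nat) (p : int) :
  x != 0 -> x != 1 -> y != 0 -> y != 1 ->
  x ^ (- A%:Z) * y ^ B%:Z != 1 ->
  antitone_galois L M ->
  (forall m, L (m + A%:Z) = L m - B%:Z) ->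
  vertex_cone_sum x y L M A B p (L (p - 1) + 1) = 0.
Proof.
move=> x0 x1 y0 y1 z1 LM LA.
have MB := antitone_galois_period LM LA.
pose G p := vertex_cone_sum x y L M A B p (L (p - 1) + 1).
have Gstep m : G m = G (m + 1).
  rewrite /G addrK.
  have L_le : L m <= L (m - 1).
    by rewrite LM; apply: le_trans (_ : m <= _); [lia | rewrite -LM].
  have MLm i : (i < absz (L (m - 1) - L m)%R)%N -> M (L m + 1 + i%:Z) = m - 1.
    move=> iN.
    have lo : m - 1 <= M (L m + 1 + i%:Z) by rewrite -LM; lia.
    have : ~~ (m <= M (L m + 1 + i%:Z)) by rewrite -LM; lia.
    by lia.
  (* Down along column [m] past empty rows, then right past an empty column. *)
  transitivity (vertex_cone_sum x y L M A B m (L m + 1)).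
    rewrite [RHS](vertex_cone_sum_rows _ (N := absz (L (m - 1) - L m)%R)) //.
      rewrite big1 ?add0r; first by congr vertex_cone_sum; lia.
      by move=> i _; rewrite MLm // subrK subrr big_ord0.
    by move=> i iN; rewrite MLm.
  have y2 : 1 - y != 0 by rewrite subr_eq0 eq_sym.
  have y3 : y - 1 != 0 by rewrite subr_eq0.
  rewrite vertex_cone_sum_column // expfzDr // expr1z.
  by rewrite [X in _ * X](_ : _ = 0) ?mulr0 ?add0r //; field; rewrite y0 y2 y3.
(* [G] is [A]-periodic, and translation along the line scales it by a factor
   other than [1]. *)
have : G (p + A%:Z) = x ^ A%:Z * y ^ (- B%:Z) * G p.
  rewrite /G -vertex_cone_sum_translate //; congr vertex_cone_sum.
  by rewrite [p + _ - 1]addrAC LA addrAC.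
rewrite -(int_succ_invariant Gstep) => /eqP.
rewrite -subr_eq0 -{1}[G p]mul1r -mulrBl mulf_eq0 subr_eq0 => /orP[|/eqP //].
by move: z1; rewrite -invr_eq1 invfM !invr_expz opprK eq_sym => /negPf ->.
Qed.

(** The hypothesis on [q] says that [(p - 1, q - 1)] lies on or below the line.
    The triangle may contain no lattice point, but the statement fails without
    some such bound: corners further above the line pick up the points of the
    opposite triangle. *)
Lemma vertex_cone_sum_lattice_points (F : fieldType) (x y : F)
    (L M : int -> int) (A B : nat) (p q : int) :
  x != 0 -> x != 1 -> y != 0 -> y != 1 ->
  x ^ (- A%:Z) * y ^ B%:Z != 1 ->
  antitone_galois L M ->
  (forall m, L (m + A%:Z) = L m - B%:Z) ->
  q <= L (p - 1) + 1 ->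
  \sum_(u \in [set u : int * int | [/\ p <= u.1, q <= u.2 & u.2 <= L u.1]]%classic)
    x ^ u.1 * y ^ u.2
  = vertex_cone_sum x y L M A B p q.
Proof.
move=> x0 x1 y0 y1 z1 LM LA qL.
set N := absz (L (p - 1) + 1 - q)%R.
pose w (i : nat) := absz (M (q + i%:Z) + 1 - p)%R.
have Mp (i : nat) : (i < N)%N -> p - 1 <= M (q + i%:Z).
  by move=> iN; rewrite -LM; lia.
rewrite (@vertex_cone_sum_rows _ x y L M A B p q N) //; last exact: antitone_galois_period LA.
have -> : q + N%:Z = L (p - 1) + 1 by rewrite /N; lia.
rewrite vertex_cone_sum_eq0 // addr0.
pose pt (i j : nat) : int * int := (p + j%:Z, q + i%:Z).
pose s := [seq pt i j | i <- index_iota 0 N, j <- index_iota 0 (w i)].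
transitivity (\sum_(u <- s) x ^ u.1 * y ^ u.2); last first.
  rewrite big_allpairs_dep /= big_mkord.
  by apply: eq_bigr => i _; rewrite big_mkord.
have us : uniq s.
  apply: allpairs_uniq_dep; rewrite ?iota_uniq //; first by move=> i _; apply: iota_uniq.
  by move=> [i j] [i' j'] _ _ /= [/addrI [->] /addrI [->]].
rewrite (fsbig_seq _ _ us); apply: eq_fsbigl.
apply/seteqP; split=> [[m n] /= [pm qn nL]|u /= /allpairsPdep[i [j []]]].
  have nL' : n <= L (p - 1).
    by rewrite LM; apply: le_trans (_ : m <= _); [lia | rewrite -LM].
  have ni : n = q + (absz (n - q)%R)%:Z by lia.
  have mM : m <= M n by rewrite -LM.
  apply/allpairsPdep; exists (absz (n - q)%R), (absz (m - p)%R).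
  rewrite !mem_index_iota /pt /w -ni; split; [lia | lia |].
  by congr pair; lia.
rewrite !mem_index_iota => iN jw ->; rewrite /pt /=.
have := Mp i iN; rewrite LM; move: jw; rewrite /w; split; lia.
Qed.

(** * Rademacher-Carlitz sums and rational right triangles *)

Lemma rademacher_carlitzE (R : realType) (F : fieldType) (u v : F) (s : R)
    (l : linexpr R) (B : nat) :
  lden l = B ->
  rademacher_carlitz u v s l
  = \sum_(k < B) u ^ Num.floor (l (Num.ceil s + k%:Z)%:~R) * v ^ (Num.ceil s + k%:Z).
Proof.
move=> lB; rewrite /rademacher_carlitz lB.
pose r := [seq Num.ceil s + k%:Z | k <- index_iota 0 B].
have ur : uniq r by rewrite map_inj_uniq ?iota_uniq // => i j; lia.
transitivity (\sum_(k <- r) u ^ Num.floor (l k%:~R) * v ^ k); last first.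
  by rewrite big_map big_mkord.
rewrite (fsbig_seq _ _ ur); apply: eq_fsbigl.
apply/seteqP; split=> [k /= kB|k /= /mapP[i]].
  by apply/mapP; exists (absz (k - Num.ceil s)%R); rewrite ?mem_index_iota; lia.
by rewrite mem_index_iota => iB ->; lia.
Qed.

(** The barycentric weights of [(u, v)] at the two acute vertices are
    [(u - u0) / (u1 - u0)] and [(v - v0) / (v1 - v0)]; the third weight is
    nonnegative exactly when [(u, v)] is on or below the hypotenuse. *)
Lemma triangle_right_angleP (R : realType) (u0 u1 v0 v1 u v : R) :
  u0 < u1 -> v0 < v1 ->
  triangle (u0, v0) (u1, v0) (u0, v1) (u, v) <->
  [/\ u0 <= u, v0 <= v & v <= v1 - (v1 - v0) / (u1 - u0) * (u - u0)].
Proof.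
move=> u01 v01.
have du : 0 < u1 - u0 by rewrite subr_gt0.
have dv : 0 < v1 - v0 by rewrite subr_gt0.
have du0 := lt0r_neq0 du; have dv0 := lt0r_neq0 dv.
split=> [[s [t [w /= [s0 t0 w0 stw [-> ->]]]]]|[u0u v0v vl]].
  have -> : s = 1 - t - w by rewrite -stw; ring.
  split; [by nra | by nra |].
  have -> : v1 - (v1 - v0) / (u1 - u0) * ((1 - t - w) * u0 + t * u1 + w * u0 - u0)
     = v1 - (v1 - v0) * t by field.
  by nra.
exists (1 - (u - u0) / (u1 - u0) - (v - v0) / (v1 - v0)),
  ((u - u0) / (u1 - u0)), ((v - v0) / (v1 - v0)); split=> /=.
- have -> : 1 - (u - u0) / (u1 - u0) - (v - v0) / (v1 - v0)
    = (v1 - (v1 - v0) / (u1 - u0) * (u - u0) - v) / (v1 - v0).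
    by field; rewrite du0 dv0.
  by rewrite divr_ge0 ?subr_ge0 // ltW.
- by rewrite divr_ge0 ?subr_ge0 // ltW.
- by rewrite divr_ge0 ?subr_ge0 // ltW.
- by ring.
- by congr pair; field; rewrite du0 dv0.
Qed.

(** * The coordinates of the rational function field *)

Lemma ratx_neq0 (K : fieldType) : ratx K != 0.
Proof. by rewrite /ratx tofrac_eq0 polyX_eq0. Qed.

Lemma raty_neq0 (K : fieldType) : raty K != 0.
Proof. by rewrite /raty tofrac_eq0 polyC_eq0 polyX_eq0. Qed.

(** Clearing denominators, equality would make ['X ^+ A] a constant polynomial
    in ['X]. *)
Lemma ratx_raty_independent (K : fieldType) (A B : nat) : (0 < A)%N ->
  ratx K ^ (- A%:Z) * raty K ^ B%:Z != 1.
Proof.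
move=> A0; rewrite -invr_expz -exprnP.
apply/eqP => /(canRL (mulVKf (expf_neq0 _ (ratx_neq0 K)))).
rewrite mulr1 -exprnP /ratx /raty -!tofracXn => /eqP.
rewrite tofrac_eq -polyC_exp => /eqP /(congr1 (fun p : {poly {poly K}} => size p)).
by rewrite size_polyXn size_polyC; case: (_ != 0); lia.
Qed.

Lemma ratx_neq1 (K : fieldType) : ratx K != 1.
Proof.
have := @ratx_raty_independent K 1 0 isT.
by rewrite expr0z mulr1 exprN1 invr_eq1.
Qed.

Lemma raty_neq1 (K : fieldType) : raty K != 1.
Proof.
rewrite /raty -tofrac1 tofrac_eq (inj_eq (@polyC_inj _)).
by apply/eqP => /(congr1 (fun p : {poly K} => size p)); rewrite size_polyX size_poly1.
Qed.

(** * The integer-point transform of a rational right triangle *)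

Theorem theorem3 (R : realType) (K : fieldType) (a b c d e f g h : int)
    (a_gt0 : 0 < a) (b_gt0 : 0 < b) (c_gt0 : 0 < c) (d_gt0 : 0 < d)
    (e_gt0 : 0 < e) (f_gt0 : 0 < f) (g_gt0 : 0 < g) (h_gt0 : 0 < h)
    (lt_ef_ab : (e%:~R / f%:~R : R) < a%:~R / b%:~R)
    (lt_gh_cd : (g%:~R / h%:~R : R) < c%:~R / d%:~R) :
  let ef : R := e%:~R / f%:~R in
  let ab : R := a%:~R / b%:~R in
  let gh : R := g%:~R / h%:~R in
  let cd : R := c%:~R / d%:~R in
  let Delta := triangle (ef, gh) (ab, gh) (ef, cd) in
  let alpha : int := d * h * (b * e - a * f) in
  let beta : int := b * f * (c * h - d * g) in
  let x : ratfun2 K := ratx K in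
  let y : ratfun2 K := raty K in
  forall l linv : linexpr R,
    (forall t : R, l t = beta%:~R / alpha%:~R * t + cd
                         - (e%:~R * beta%:~R) / (f%:~R * alpha%:~R)) ->
    lden l = `|alpha| ->
    cancel l linv -> cancel linv l ->
    lden linv = beta ->
  integer_point_transform Delta x y =
    x ^ Num.ceil ef * y ^ Num.ceil gh / ((1 - x) * (1 - y))
    + rademacher_carlitz x y gh linv / ((1 - x ^-1) * (1 - x ^ alpha * y ^ beta))
    + rademacher_carlitz y x ef l
        / ((1 - y ^-1) * (1 - x ^ (- alpha) * y ^ (- beta))).
Proof.
move=> ef ab gh cd Delta alpha beta x y l linv lE lden_l lK linvK lden_linv.
have fR : f%:~R != 0 :> R by rewrite intr_eq0 gt_eqF.
have bR : b%:~R != 0 :> R by rewrite intr_eq0 gt_eqF.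
have dR : d%:~R != 0 :> R by rewrite intr_eq0 gt_eqF.
have hR : h%:~R != 0 :> R by rewrite intr_eq0 gt_eqF.
have alpha_lt0 : alpha < 0.
  move: lt_ef_ab; rewrite ltr_pdivrMr ?ltr0z // mulrAC ltr_pdivlMr ?ltr0z //.
  by rewrite -!intrM ltr_int /alpha; nia.
have beta_gt0 : 0 < beta by rewrite -lden_linv lden_gt0.
have alphaR : alpha%:~R != 0 :> R by rewrite intr_eq0 lt_eqF.
have width_neq0 : ab - ef != 0 by rewrite subr_eq0 gt_eqF.
(* Both coefficients are multiples of the side lengths, with the common factor
   [b * f * d * h]. *)
have slopeE : beta%:~R / alpha%:~R = - ((cd - gh) / (ab - ef)).
  have -> : alpha%:~R = - (b * f * d * h)%:~R * (ab - ef).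
    by rewrite /alpha !(intrM, intrB) /ab /ef; field; rewrite bR fR.
  have -> : beta%:~R = (b * f * d * h)%:~R * (cd - gh).
    by rewrite /beta !(intrM, intrB) /cd /gh; field; rewrite dR hR.
  by rewrite !intrM; field; rewrite width_neq0 bR fR dR hR.
have l_line t : l t = cd - (cd - gh) / (ab - ef) * (t - ef).
  rewrite lE; have -> : e%:~R * beta%:~R / (f%:~R * alpha%:~R) = beta%:~R / alpha%:~R * ef.
    by rewrite /ef; field; rewrite fR alphaR.
  by rewrite slopeE; ring.
have slope_gt0 : 0 < (cd - gh) / (ab - ef) by rewrite divr_gt0 // subr_gt0.
have l_anti s t : (l s <= l t) = (t <= s).
  by rewrite !l_line lerD2l lerN2 ler_pM2l // lerD2r.
pose L (m : int) := Num.floor (l m%:~R).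
pose M (n : int) := Num.floor (linv n%:~R).
have LM : antitone_galois L M.
  by move=> m n; rewrite /L /M !floor_ge_int -[in LHS](linvK n%:~R) l_anti.
have x0 : x != 0 := ratx_neq0 K.
have y0 : y != 0 := raty_neq0 K.
have x1 : x != 1 := ratx_neq1 K.
have y1 : y != 1 := raty_neq1 K.
have z_neq1 (A B : nat) : (0 < A)%N -> x ^ (- A%:Z) * y ^ B%:Z != 1.
  exact: ratx_raty_independent.
(* The values of [alpha], [beta], [x], [y] no longer matter: the signs and
   inequations above, and the equation of [l], are all that is used. *)
clearbody alpha beta x y.
have [A alphaE] : exists A : nat, alpha = - A%:Z.
  by exists (absz alpha); rewrite ltz0_abs ?opprK.
have [B betaE] : exists B : nat, beta = B%:Z.
  by exists (absz beta); rewrite gtz0_abs.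
have A_gt0 : (0 < A)%N by rewrite -ltz_nat -oppr_lt0 -alphaE.
have LA m : L (m + A%:Z) = L m - B%:Z.
  rewrite /L; have -> : l (m + A%:Z)%:~R = l m%:~R + (- B%:Z)%:~R.
    rewrite !lE -betaE -[A%:Z]opprK -alphaE rmorphB rmorphN /=.
    by field; rewrite fR alphaR.
  by rewrite floorDrz ?intr_int // intrKfloor.
have z1 : x ^ (- A%:Z) * y ^ B%:Z != 1 by exact: z_neq1.
rewrite (rademacher_carlitzE _ _ _ (B := B)) ?lden_linv //.
rewrite (rademacher_carlitzE _ _ _ (B := A)); last first.
  by rewrite lden_l ltr0_norm // alphaE opprK.
rewrite alphaE betaE opprK -[RHS]/(vertex_cone_sum x y L M A B (Num.ceil ef) (Num.ceil gh)).
(* The corner of the unit square below and left of [(p, q)] lies below the line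
   even if [(p, q)] does not: its abscissa is less than [ef], where the line is
   at height [cd], and its ordinate is less than [gh]. *)
have apex : Num.ceil gh <= L (Num.ceil ef - 1) + 1.
  rewrite -lerBlDr /L floor_ge_int.
  have /andP[p_lt _] := ceil_itv ef.
  have /andP[q_lt _] := ceil_itv gh.
  apply: (le_trans (ltW q_lt)); apply: (le_trans (ltW lt_gh_cd)).
  have -> : c%:~R / d%:~R = l ef :> R by rewrite l_line subrr mulr0 subr0.
  by rewrite l_anti ltW.
rewrite -(vertex_cone_sum_lattice_points x0 x1 y0 y1 z1 LM LA apex).
rewrite /integer_point_transform; apply: eq_fsbigl.
apply/seteqP; split=> [[m n]|[m n]] /=.
  move=> /(triangle_right_angleP _ _ lt_ef_ab lt_gh_cd)[em gn nl].
  by rewrite !ceil_le_int floor_ge_int l_line; split.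
rewrite !ceil_le_int floor_ge_int l_line => -[em gn nl].
by apply/(triangle_right_angleP _ _ lt_ef_ab lt_gh_cd).
Qed.
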